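(* In the unbounded forecasting game, let $E\subset\Xi$ be an event. If Skeptic can force $E$, then Reality strongly complies with $E$.
   Context: Unbounded forecasting game: $\mathcal K_0=1$. For $n=1,2,\ldots$: Forecaster announces $m_n\in\mathbb R$ and $v_n>0$; Skeptic announces $M_n\in\mathbb R$ and $V_n\ge0$; Reality announces $x_n\in\mathbb R$; and $\mathcal K_n:=\mathcal K_{n-1}+M_n(x_n-m_n)+V_n((x_n-m_n)^2-v_n)$. All moves are public. Skeptic's collateral duty is to keep $\mathcal K_n$ non-negative; Forecaster has no duty other than making allowed moves. A path is an infinite sequence $\xi=(m_1,v_1,x_1,m_2,v_2,x_2,\ldots)$ of allowed moves of Forecaster and Reality; $\Xi$ is the set of paths; an event is any subset of $\Xi$. A strategy $\mathcal P$ of Skeptic specifies his allowed move $(M_n,V_n)$ at each round $n$ as a function of $m_1,v_1,x_1,\ldots,m_{n-1},v_{n-1},x_{n-1},m_n,v_n$. Its capital process is $\mathcal K^{\mathcal P}_0=0$, $\mathcal K^{\mathcal P}_n=\mathcal K^{\mathcal P}_{n-1}+M_n(x_n-m_n)+V_n((x_n-m_n)^2-v_n)$ with $(M_n,V_n)$ given by $\mathcal P$. Skeptic can force an event $E$ if there is a strategy $\mathcal P$ such that $\mathcal K^{\mathcal P}_n(\xi)\ge-1$ for all $\xi\in\Xi$, $n\ge0$, and $\limsup_n\mathcal K^{\mathcal P}_n(\xi)=\infty$ for every $\xi\notin E$. Write $\mu_n=(m_n,v_n)$ and $\mathfrak m_n=(M_n,V_n)$. A (deterministic) strategy of Reality is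 a sequence $\mathcal R=\{\mathcal R_n\}_{n\ge1}$ of functions with $x_n=\mathcal R_n(\mu_1,\mathfrak m_1,\ldots,\mu_n,\mathfrak m_n)$. By $\mathcal R$ Reality strongly complies with $E$ if, irrespective of the moves $\mu_n,\mathfrak m_n$, $n\ge1$, of Forecaster and Skeptic, both observing their collateral duties, when Reality plays $\mathcal R$: (i) the resulting path $(\mu_1,x_1,\mu_2,x_2,\ldots)$ belongs to $E$, and (ii) $\mathcal K_n\le1=\mathcal K_0$ for all $n$. Reality strongly complies with $E$ if such an $\mathcal R$ exists. *)

(* Defs.v *)
From mathcomp Require Import all_boot all_order all_algebra.
From mathcomp Require Import all_classical all_reals all_analysis.

Set Implicit Arguments.
Unset Strict Implicit.
Unset Printing Implicit Defensive.

Import Order.TTheory GRing.Theory Num.Theory.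

Local Open Scope classical_set_scope.
Local Open Scope ring_scope.

(* Rounds are numbered from 0: index i stands for round i + 1 of the game.
   Allowedness of moves (v > 0, V >= 0) is carried by the types. *)

(* mu = (m, v) *)
Definition forecaster_move (R : realType) : Type := (R * {posnum R})%type.

(* (M, V) *)
Definition skeptic_move (R : realType) : Type := (R * {nonneg R})%type.

Definition game_path (R : realType) : Type := nat -> forecaster_move R * R.

Definition event (R : realType) : Type := set (game_path R).

Definition gain (R : realType) (mu : forecaster_move R) (s : skeptic_move R)
    (x : R) : R :=
  s.1 * (x - mu.1) + s.2%:num * ((x - mu.1) ^+ 2 - mu.2%:num).

Fixpoint capital (R : realType) (K0 : R) (mu : nat -> forecaster_move R)
    (s : nat -> skeptic_move R) (x : nat -> R) (n : nat) : R :=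
  if n is k.+1 then capital K0 mu s x k + gain (mu k) (s k) (x k) else K0.

(* The list is the history (m_1, v_1, x_1), ..., (m_{n-1}, v_{n-1}, x_{n-1})
   in chronological order; its length determines the round. *)
Definition skeptic_strategy (R : realType) : Type :=
  seq (forecaster_move R * R) -> forecaster_move R -> skeptic_move R.

Definition skeptic_response (R : realType) (P : skeptic_strategy R)
    (xi : game_path R) (n : nat) : skeptic_move R :=
  P (mkseq xi n) (xi n).1.

Definition capital_process (R : realType) (P : skeptic_strategy R)
    (xi : game_path R) : nat -> R :=
  capital 0 (fun n => (xi n).1) (skeptic_response P xi) (fun n => (xi n).2).

Definition can_force (R : realType) (E : event R) : Prop :=
  exists P : skeptic_strategy R,
    (forall (xi : game_path R) (n : nat), -1 <= capital_process P xi n) /\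
    (forall xi : game_path R, ~ E xi ->
       limn_esup (fun n => (capital_process P xi n)%:E) = +oo%E).

(* The list is (mu_1, (M_1, V_1)), ..., (mu_n, (M_n, V_n)): Reality moves last,
   so it includes the opponents' moves of the current round. *)
Definition reality_strategy (R : realType) : Type :=
  seq (forecaster_move R * skeptic_move R) -> R.

Definition reality_response (R : realType) (Q : reality_strategy R)
    (mu : nat -> forecaster_move R) (s : nat -> skeptic_move R) (n : nat) : R :=
  Q (mkseq (fun i => (mu i, s i)) n.+1).

(* Skeptic's collateral duty is required only along the play that actually
   occurs; Forecaster's duty is already part of forecaster_move. *)
Definition strongly_complies_by (R : realType) (Q : reality_strategy R)
    (E : event R) : Prop :=
  forall (mu : nat -> forecaster_move R) (s : nat -> skeptic_move R),
    let x := reality_response Q mu s in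
    let K := capital 1 mu s x in
    (forall n : nat, 0 <= K n) ->
    E (fun n => (mu n, x n)) /\ (forall n : nat, K n <= 1).

Definition strongly_complies (R : realType) (E : event R) : Prop :=
  exists Q : reality_strategy R, strongly_complies_by Q E.

(* Main.v *)
Require Import Defs.
From mathcomp Require Import all_boot all_order all_algebra.
From mathcomp Require Import all_classical all_reals all_analysis.

(** Reality complies by always playing [x_n = m_n].  The linear part of
    Skeptic's bet then pays nothing and the quadratic part pays
    [- V_n v_n <= 0], so every strategy of Skeptic has a nonincreasing capital
    against these moves ([capital_le_initial]).  Applied to Skeptic's actual
    moves, this bounds his capital by the initial value 1.  Applied to a
    strategy that forces [E], it bounds that strategy's capital process by 0,
    so its upper limit is not infinite and the path must belong to [E]. *)

Import Order.TTheory GRing.Theory Num.Theory.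
Local Open Scope ring_scope.

Lemma gain_at_mean_le0 (R : realType) (mu : forecaster_move R)
    (s : skeptic_move R) : gain mu s mu.1 <= 0.
Proof.
by rewrite /gain subrr mulr0 add0r expr0n/= sub0r mulrN oppr_le0 mulr_ge0.
Qed.

Lemma capital_le_initial (R : realType) (K0 : R) (mu : nat -> forecaster_move R)
    (s : nat -> skeptic_move R) (x : nat -> R) :
  (forall n, x n = (mu n).1) -> forall n, capital K0 mu s x n <= K0.
Proof.
move=> xE; elim=> [|n IHn] //=.
by rewrite xE -[leRHS]addr0 lerD// gain_at_mean_le0.
Qed.

Lemma limn_esup_le_ub (R : realType) (u : nat -> \bar R) (b : \bar R) :
  (forall n, (u n <= b)%E) -> (limn_esup u <= b)%E.
Proof.
move=> ub; rewrite limn_esup_lim; apply: lime_le; first exact: is_cvg_esups.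
by apply: nearW => n; apply: ge_ereal_sup => _ [k _ <-].
Qed.

Definition play_mean (R : realType) : reality_strategy R :=
  fun h => last 0 [seq a.1.1 | a <- h].

Lemma play_meanE (R : realType) (mu : nat -> forecaster_move R)
    (s : nat -> skeptic_move R) (n : nat) :
  reality_response (@play_mean R) mu s n = (mu n).1.
Proof.
rewrite /reality_response /play_mean -map_comp -nth_last size_map size_iota.
exact: (nth_mkseq _ (fun i => (mu i).1) (ltnSn n)).
Qed.

Theorem proposition4p10 (R : realType) (E : event R) :
  can_force E -> strongly_complies E.
Proof.
move=> [P [_ P_forces]]; exists (@play_mean R) => mu s x K _.
have xE n : x n = (mu n).1 by exact: play_meanE.
split; last exact: capital_le_initial.
apply: contrapT => /P_forces limP.
suff : (limn_esup (fun n =>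
    (capital_process P (fun k => (mu k, x k)) n)%:E) <= 0)%E by rewrite limP.
by apply: limn_esup_le_ub => n; rewrite lee_fin; apply: capital_le_initial.
Qed.
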